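(* For any $\alpha>0$ there exists a randomized online algorithm (a variant of \textsc{Ranking}) for the Online Vertex-Weighted Bipartite Matching Problem such that for any instance $G=(S,B,E)$ with weights $w:S\to\mathbb{R}_+$, any arrival order of $B$, and any matching $M^*$ of $G$, \[ \mathbb{P}\left[w(M) < \left(1-\frac{1}{e}-\alpha\right)w(M^* )\right] < e^{-\frac{1}{50}\alpha^4\frac{w(M^* )^2}{\|w\|_2^2}}, \] where $M$ denotes the matching generated by the algorithm, $w(M)\coloneqq\sum_{\{i,j\}\in M} w_j$ with $j\in S$ the seller endpoint of each edge, and $\|w\|_2^2=\sum_{j\in S}w_j^2$.
   Context: Online Vertex-Weighted Bipartite Matching Problem: $G=(S,B,E)$ is a bipartite graph with offline vertices $S$ carrying nonnegative weights $w:S\to\mathbb{R}_+$ and online vertices $B$ that arrive one at a time in adversarial order. When $i\in B$ arrives, its neighborhood $N(i)\subseteq S$ is revealed and the algorithm must irrevocably match $i$ to a currently unmatched neighbor or leave it unmatched. The goal is to maximize the total weight of matched offline vertices. *)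

(* Defs.v *)
From HB Require Import structures.
From mathcomp Require Import all_boot all_order all_algebra.
From mathcomp Require Import all_classical all_reals all_analysis.
Set Implicit Arguments. Unset Strict Implicit. Unset Printing Implicit Defensive.
Import Order.TTheory GRing.Theory Num.Theory.
Local Open Scope ring_scope.

(* Online vertex-weighted bipartite matching.
   Sellers (offline vertices) form a finite type [S] with weights [w : S -> R].
   Buyers (online vertices) are given by the sequence [ns] of their
   neighbourhoods, in arrival order: buyer [i] is the [i]-th entry. *)

(* A randomized online algorithm for a fixed offline side (S, w):
   a random seed drawn from a probability space, and a decision rule that,
   given the seed and the sequence of neighbourhoods revealed so far (the last
   one being that of the currently arriving buyer), proposes a seller or no
   match.  A proposal that is not an unmatched neighbour is treated as "leave
   unmatched".  Decisions are required to be measurable in the seed. *)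
Record RandOnlineAlg (R : realType) (S : finType) := {
  ra_disp : measure_display;
  ra_space : measurableType ra_disp;
  ra_prob : probability ra_space R;
  ra_dec : ra_space -> seq {set S} -> option S;
  ra_meas : forall (h : seq {set S}) (o : option S),
      measurable [set x | ra_dec x h = o]
}.

Fixpoint run_online (S : finType) (dec : seq {set S} -> option S)
    (hist : seq {set S}) (matched : {set S}) (ns : seq {set S})
    : seq (option S) :=
  match ns with
  | [::] => [::]
  | N :: ns' =>
      let h := rcons hist N in
      let c := match dec h with
               | Some j => if (j \in N) && (j \notin matched) then Some j else None
               | None => None
               end in
      c :: run_online dec h (if c is Some j then j |: matched else matched) ns'
  end.

Definition assign_weight (R : realType) (S : finType) (w : S -> R)
    (s : seq (option S)) : R :=
  \sum_(c <- s) (if c is Some j then w j else 0).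

Definition alg_weight (R : realType) (S : finType) (w : S -> R)
    (A : RandOnlineAlg R S) (ns : seq {set S}) (x : ra_space A) : R :=
  assign_weight w (run_online (ra_dec x) [::] (finset.set0 : {set S}) ns).

Definition is_matching (S : finType) (ns : seq {set S})
    (m : 'I_(size ns) -> option S) : Prop :=
  (forall (i : 'I_(size ns)) (j : S), m i = Some j -> j \in nth (finset.set0 : {set S}) ns i) /\
  (forall (i i' : 'I_(size ns)) (j : S), m i = Some j -> m i' = Some j -> i = i').

Definition matching_weight (R : realType) (S : finType) (w : S -> R)
    (ns : seq {set S}) (m : 'I_(size ns) -> option S) : R :=
  \sum_(i < size ns) (if m i is Some j then w j else 0).

Definition norm2sq (R : realType) (S : finType) (w : S -> R) : R :=
  \sum_(j : S) w j ^+ 2.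

(* Main.v *)
Require Import Defs.
From HB Require Import structures.
From mathcomp Require Import all_boot all_order all_algebra.
From mathcomp Require Import all_classical all_reals all_analysis.
From mathcomp Require Import ring lra.
Import Order.TTheory GRing.Theory Num.Theory.
Local Open Scope ring_scope.

(** Sellers draw independent prices [w j * g (x j)], with [g (x)] a discretised
   [e^(x-1)] capped at [1 - d], and each buyer takes the free neighbour with the
   largest surplus.  Splitting the weight of a sold seller between its price and
   the surplus of its buyer shows that each edge of a matching collects, in
   expectation, a [1 - 1/e - O(d^2)] fraction of the weight of its seller.
   Redrawing the price of seller [j] only displaces sellers of smaller surplus;
   as the cap makes the surplus of [k] at least [d * w k], this moves the total
   weight by at most [w j / d], and a bounded-differences inequality with
   [d = 2 alpha / 3] concludes. *)

(** * Means over finite types and bounded differences *)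

Section Mean.
Context {R : realType}.

Definition mean (T : finType) (F : T -> R) : R := #|T|%:R^-1 * \sum_x F x.

Lemma eq_mean (T : finType) (F G : T -> R) : F =1 G -> mean T F = mean T G.
Proof. by move=> FG; congr (_ * _); apply: eq_bigr => x _; apply: FG. Qed.

Lemma mean_ge0 (T : finType) (F : T -> R) : (forall x, 0 <= F x) -> 0 <= mean T F.
Proof. by move=> F0; rewrite mulr_ge0 ?invr_ge0 ?ler0n// sumr_ge0. Qed.

Lemma ler_mean (T : finType) (F G : T -> R) :
  (forall x, F x <= G x) -> mean T F <= mean T G.
Proof. by move=> FG; rewrite ler_wpM2l ?invr_ge0 ?ler0n// ler_sum. Qed.

Lemma meanD (T : finType) (F G : T -> R) :
  mean T (fun x => F x + G x) = mean T F + mean T G.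
Proof. by rewrite /mean big_split mulrDr. Qed.

Lemma meanZ (T : finType) (c : R) (F : T -> R) :
  mean T (fun x => c * F x) = c * mean T F.
Proof. by rewrite /mean -mulr_sumr mulrCA. Qed.

Lemma mean_sum (T I : finType) (P : pred I) (F : I -> T -> R) :
  mean T (fun x => \sum_(i | P i) F i x) = \sum_(i | P i) mean T (F i).
Proof. by rewrite /mean exchange_big mulr_sumr. Qed.

Lemma exchange_mean (T U : finType) (F : T -> U -> R) :
  mean T (fun x => mean U (F x)) = mean U (fun y => mean T (F^~ y)).
Proof.
rewrite /mean -!mulr_sumr exchange_big mulrCA.
by congr (_ * _); rewrite -mulr_sumr.
Qed.

Lemma mean_const (T : finType) (c : R) : (0 < #|T|)%N -> mean T (fun=> c) = c.
Proof.
move=> T0; rewrite /mean big_const iter_addr_0 -[c *+ _]mulr_natl mulKf//.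
by rewrite pnatr_eq0 -lt0n.
Qed.

Lemma ler_norm_mean (T : finType) (G : T -> R) (d : R) :
  (0 < #|T|)%N -> (forall x, `|G x| <= d) -> `|mean T G| <= d.
Proof.
move=> T0 Gd; rewrite -[leRHS](mean_const T d T0) ler_norml -mulN1r -meanZ.
by apply/andP; split; apply: ler_mean => x; have := Gd x; rewrite ler_norml => /andP[]; lra.
Qed.

Lemma meanB (T : finType) (F G : T -> R) :
  mean T (fun x => F x - G x) = mean T F - mean T G.
Proof.
by rewrite meanD -mulN1r -meanZ; congr (_ + _); apply: eq_mean => x; rewrite mulN1r.
Qed.

Lemma markov_expR (T : finType) (F : T -> R) (p : pred T) (s t : R) :
  0 <= s -> (forall x, p x -> t <= F x) ->
  mean T (fun x => (p x)%:R) <= expR (- (s * t)) * mean T (fun x => expR (s * F x)).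
Proof.
move=> s0 pF; rewrite -meanZ; apply: ler_mean => x.
case: (boolP (p x)) => [/pF tF|_]; last by rewrite mulr_ge0 ?expR_ge0.
rewrite -expRD mulr1n; apply: le_trans (expR_ge1Dx _).
by have := ler_wpM2l s0 tF; lra.
Qed.

(** The linear term averages out for a centred variable, which gives Hoeffding's lemma with a larger
    constant and no convexity argument. For [z >= 1/2] one has [z <= 2 z^2]; for smaller [z],
    [e^z <= 1 / (1 - z) <= 1 + z + 2 z^2]. *)
Lemma expR_le_subgauss (z : R) : expR z <= z + expR (2 * z ^+ 2).
Proof.
have e1 := expR_ge1Dx (2 * z ^+ 2).
have [z2|z2] := leP (2^-1) z.
  have : expR z <= expR (2 * z ^+ 2) by rewrite ler_expR; nra.
  by move=> h; lra.
have iz : expR z * (1 - z) <= 1.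
  rewrite -[leRHS](expRxMexpNx_1 z) ler_wpM2l ?expR_ge0//.
  by have := expR_ge1Dx (- z); lra.
have : expR z * (1 - z) <= (1 + z + 2 * z ^+ 2) * (1 - z).
  by apply: le_trans iz _; rewrite !expr2; nra.
by rewrite ler_pM2r; lra.
Qed.

Lemma mgf_centered (T : finType) (G : T -> R) (d s : R) :
  (0 < #|T|)%N -> mean T G = 0 -> (forall x, `|G x| <= d) ->
  mean T (fun x => expR (s * G x)) <= expR (2 * s ^+ 2 * d ^+ 2).
Proof.
move=> T0 G0 Gd.
have -> : expR (2 * s ^+ 2 * d ^+ 2) =
    mean T (fun x => s * G x + expR (2 * s ^+ 2 * d ^+ 2)).
  by rewrite meanD meanZ G0 mulr0 add0r mean_const.
apply: ler_mean => x; apply: le_trans (expR_le_subgauss _) _.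
rewrite lerD2l ler_expR exprMn -mulrA !ler_wpM2l// ?sqr_ge0//.
rewrite -[G x ^+ 2]real_normK ?num_real// !expr2.
by have := Gd x; have := normr_ge0 (G x); nra.
Qed.

End Mean.

(** * Bounded differences on a finite product space *)

Section BoundedDifferences.
Context {R : realType} {I K : finType}.
Hypothesis K_gt0 : (0 < #|K|)%N.
Implicit Types (x y : {ffun I -> K}) (F : {ffun I -> K} -> R) (c : I -> R).

Definition upd x i a : {ffun I -> K} := [ffun j => if j == i then a else x j].

(** The conditional expectation of [F] given all coordinates but [i], under the uniform law. *)
Definition resample i F x : R := mean K (fun a => F (upd x i a)).

Definition bounded_diff c F := forall i x a, `|F (upd x i a) - F x| <= c i.

Lemma mean_resample i F : mean _ (resample i F) = mean _ F.
Proof.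
rewrite /resample exchange_mean.
(* Swapping [x i] with the fresh value [a] permutes the pairs, so a resampled point is again
   uniform. *)
pose h (p : {ffun I -> K} * K) := (upd p.1 i p.2, p.1 i).
have hK : involutive h.
  move=> [x a]; rewrite /h /=; congr pair; last by rewrite ffunE eqxx.
  by apply/ffunP => j; rewrite !ffunE; case: eqP => // ->.
rewrite /mean -mulr_sumr exchange_big pair_big_dep /=.
rewrite (reindex_inj (can_inj hK)) /=.
under eq_bigr => p _.
  have -> : upd (h p).1 i (h p).2 = p.1 by have := hK p; rewrite {1}/h; case: p => ? ? [].
  over.
rewrite -(pair_big_dep xpredT (fun _ _ => true) (fun x _ => F x)) /=.
under eq_bigr => x _ do rewrite big_const iter_addr_0 -[F x *+ _]mulr_natl.
rewrite -mulr_sumr !mulrA; congr (_ * _).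
by rewrite mulrAC mulVf ?mul1r// pnatr_eq0 -lt0n.
Qed.

Lemma updC x i j a b : i != j -> upd (upd x i a) j b = upd (upd x j b) i a.
Proof.
move=> ij; apply/ffunP => k; rewrite !ffunE.
by case: (eqVneq k j) => // ->; rewrite eq_sym (negPf ij).
Qed.

Lemma upd_upd x i a b : upd (upd x i a) i b = upd x i b.
Proof. by apply/ffunP => k; rewrite !ffunE; case: eqP. Qed.

Lemma bounded_diff_resample c F i :
  (forall j, 0 <= c j) -> bounded_diff c F -> bounded_diff c (resample i F).
Proof.
move=> c0 cF j x a; rewrite /resample -meanB.
apply: ler_norm_mean => // b.
have [->|ij] := eqVneq i j; first by rewrite upd_upd subrr normr0.
by rewrite updC 1?eq_sym.
Qed.

(** Given the other coordinates, [F - resample i F] is centred and bounded by [c i], so averaging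
    out one coordinate costs one sub-Gaussian factor. *)
Lemma mgf_resample c F i (s : R) : bounded_diff c F ->
  mean _ (fun x => expR (s * F x)) <=
  expR (2 * s ^+ 2 * c i ^+ 2) * mean _ (fun x => expR (s * resample i F x)).
Proof.
move=> cF; rewrite -(mean_resample i) -meanZ; apply: ler_mean => x.
rewrite /resample.
set m := mean K (fun a => F (upd x i a)).
have -> : mean K (fun a => expR (s * F (upd x i a))) =
    expR (s * m) * mean K (fun a => expR (s * (F (upd x i a) - m))).
  by rewrite -meanZ; apply: eq_mean => a; rewrite -expRD; congr expR; ring.
rewrite mulrC; apply: ler_wpM2r; rewrite ?expR_ge0//; apply: mgf_centered => //.
  by rewrite meanB mean_const// subrr.
move=> a; rewrite -(mean_const K (F (upd x i a)) K_gt0) /m -meanB.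
apply: ler_norm_mean => // b.
by have := cF i (upd x i b) a; rewrite upd_upd.
Qed.

(** The Doob martingale of [F]: it reaches the constant [mean F] once every coordinate is averaged
    out. *)
Definition resample_seq := foldr resample.

Lemma bounded_diff_resample_seq c F r :
  (forall j, 0 <= c j) -> bounded_diff c F -> bounded_diff c (resample_seq F r).
Proof. by move=> c0 cF; elim: r => //= i r IH; apply: bounded_diff_resample. Qed.

Lemma mgf_resample_seq c F r (s : R) : (forall j, 0 <= c j) -> bounded_diff c F ->
  mean _ (fun x => expR (s * F x)) <=
  expR (2 * s ^+ 2 * \sum_(i <- r) c i ^+ 2) *
    mean _ (fun x => expR (s * resample_seq F r x)).
Proof.
move=> c0 cF; elim: r => [|i r IH]; first by rewrite big_nil mulr0 expR0 mul1r.
apply: le_trans IH _; rewrite big_cons mulrDr addrC expRD -[leRHS]mulrA.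
apply: ler_wpM2l; rewrite ?expR_ge0//; apply: mgf_resample.
exact: bounded_diff_resample_seq.
Qed.

Lemma resample_seq_local F r x y :
  (forall i, i \notin r -> x i = y i) -> resample_seq F r x = resample_seq F r y.
Proof.
elim: r x y => [|i r IH] x y xy /=; first by congr F; apply/ffunP => i; apply: xy.
apply: eq_mean => a; apply: IH => j jr; rewrite !ffunE; case: eqVneq => // ji.
by apply: xy; rewrite inE negb_or ji.
Qed.

Lemma mean_resample_seq F r : mean _ (resample_seq F r) = mean _ F.
Proof. by elim: r => //= i r <-; rewrite mean_resample. Qed.

Lemma mgf_bounded_diff c F (s : R) : (forall j, 0 <= c j) -> bounded_diff c F ->
  mean _ (fun x => expR (s * (F x - mean _ F))) <=
  expR (2 * s ^+ 2 * \sum_i c i ^+ 2).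
Proof.
move=> c0 cF.
have T0 : (0 < #|{ffun I -> K}|)%N by rewrite card_ffun expn_gt0 K_gt0.
have cst x : resample_seq F (enum I) x = mean _ F.
  rewrite -(mean_resample_seq F (enum I)) -[LHS](mean_const {ffun I -> K} _ T0).
  by apply: eq_mean => y; apply: resample_seq_local => i; rewrite mem_enum.
have := mgf_resample_seq c F (enum I) s c0 cF.
under [X in _ <= _ * X]eq_mean => x do rewrite cst.
rewrite mean_const// big_enum => H.
under eq_mean => x.
  have -> : s * (F x - mean _ F) = - (s * mean _ F) + s * F x by ring.
  rewrite expRD; over.
by rewrite meanZ expRN mulrC ler_pdivrMr ?expR_gt0.
Qed.

(** McDiarmid's lower tail, with 1/8 in place of the optimal 2, by the Chernoff method applied to
    [mean F - F]. *)
Lemma bounded_diff_tail c F (p : pred {ffun I -> K}) (t : R) :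
  (forall j, 0 <= c j) -> bounded_diff c F -> 0 <= t -> 0 < \sum_i c i ^+ 2 ->
  (forall x, p x -> F x <= mean _ F - t) ->
  mean _ (fun x => (p x)%:R) <= expR (- (t ^+ 2 / (8 * \sum_i c i ^+ 2))).
Proof.
move=> c0 cF t0 V0 pF; set V := \sum_i c i ^+ 2 in V0 *.
(* The minimiser of [2 s^2 V - s t], whose minimum is [- t^2 / (8 V)]. *)
pose s := t / (4 * V).
have s0 : 0 <= s by rewrite divr_ge0//; lra.
have pF' x : p x -> t <= mean _ F - F x by move=> /pF; lra.
apply: le_trans (markov_expR _ _ p s t s0 pF') _.
have := mgf_bounded_diff c F (- s) c0 cF.
under eq_mean => x do rewrite mulNr -mulrN opprB.
move=> /(ler_wpM2l (expR_ge0 (- (s * t)))) /le_trans; apply.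
rewrite -expRD ler_expR -/V /s le_eqVlt; apply/orP; left; apply/eqP.
by field; rewrite gt_eqF.
Qed.

End BoundedDifferences.

(** * Greedy matching along a preference order *)

Section Greedy.
Context {R : realType} {S : finType}.
Implicit Types (score w : S -> R) (F A N : {set S}) (ns : seq {set S}) (c : option S).

(** Breaking ties by [enum_rank] makes the order antisymmetric, so the best free neighbour is
    unique. *)
Definition preferred score j k :=
  (score k < score j) || ((score k == score j) && (enum_rank j <= enum_rank k)%N).

Lemma preferred_score score j k : preferred score j k -> score k <= score j.
Proof. by case/orP => [/ltW//|/andP[/eqP->]]. Qed.

Lemma preferred_refl score : reflexive (preferred score).
Proof. by move=> j; rewrite /preferred eqxx leqnn orbT. Qed.

Lemma preferred_trans score : transitive (preferred score).
Proof.
move=> k j l /orP[jk|/andP[/eqP jk jk']] /orP[kl|/andP[/eqP kl kl']].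
- by rewrite /preferred (lt_trans kl jk).
- by rewrite /preferred kl jk.
- by rewrite /preferred -jk kl.
- by rewrite /preferred kl jk eqxx (leq_trans jk' kl') orbT.
Qed.

Lemma preferred_total score : total (preferred score).
Proof.
by move=> j k; rewrite /preferred; case: ltgtP => //= _; rewrite leq_total.
Qed.

Lemma preferred_anti score : antisymmetric (preferred score).
Proof.
move=> j k; rewrite /preferred; case: ltgtP => //= _ h.
by apply/enum_rank_inj/val_inj/anti_leq.
Qed.

Definition best score A : option S :=
  [pick j in A | [forall k in A, preferred score j k]].

Variant best_spec score A : option S -> Type :=
| BestSome j of j \in A & (forall k, k \in A -> preferred score j k) :
    best_spec score A (Some j)
| BestNone of A = finset.set0 : best_spec score A None.

Lemma bestP score A : best_spec score A (best score A).
Proof.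
rewrite /best; case: pickP => [j /andP[jA /forall_inP jk]|no]; first by constructor.
constructor; apply/eqP; apply: contraT => /set0Pn[j0 j0A].
pose s := sort (preferred score) (enum A).
have s_mem j : (j \in s) = (j \in A) by rewrite mem_sort mem_enum.
have s_sorted : sorted (preferred score) s by apply/sort_sorted/preferred_total.
case sE : s s_sorted => [|j r] /=; first by move: j0A; rewrite -s_mem sE.
move=> /(order_path_min (@preferred_trans score))/allP jr.
have := no j; rewrite -s_mem sE mem_head /= => /forall_inP[] k.
by rewrite -s_mem sE inE => /predU1P[->|/jr//]; apply: preferred_refl.
Qed.

Lemma best_eq score A j : j \in A -> (forall k, k \in A -> preferred score j k) ->
  best score A = Some j.
Proof.
move=> jA jk; case: bestP => [k kA kj|A0]; last by rewrite A0 inE in jA.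
by congr Some; apply: (@preferred_anti score); rewrite jk// kj.
Qed.

Lemma eq_best score score' A : {in A, score =1 score'} -> best score A = best score' A.
Proof.
move=> ss'; apply: eq_pick => j /=.
case jA: (j \in A) => //=.
by apply/forall_inP/forall_inP => h k kA; move: (h k kA); rewrite /preferred !ss'.
Qed.

Definition remove c F := if c is Some j then F :\ j else F.

Fixpoint greedy score F ns : seq (option S) :=
  if ns is N :: ns' then
    let c := best score (N :&: F) in c :: greedy score (remove c F) ns'
  else [::].

Lemma size_greedy score F ns : size (greedy score F ns) = size ns.
Proof. by elim: ns F => //= N ns IH F; rewrite IH. Qed.

Lemma eq_greedy score score' F ns : {in F, score =1 score'} ->
  greedy score F ns = greedy score' F ns.
Proof.
elim: ns F => //= N ns IH F ss'.
rewrite (@eq_best score score'); last by move=> j /setIP[_]; apply: ss'.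
congr (_ :: _); apply: IH; case: best => //= k j.
by rewrite !inE => /andP[_]; apply: ss'.
Qed.

Lemma greedy_mem score F ns j : Some j \in greedy score F ns -> j \in F.
Proof.
elim: ns F => //= N ns IH F; rewrite inE => /predU1P[|/IH].
  by case: bestP => [k /setIP[_ kF] _ [->]|].
by case: best => //= k /setD1P[].
Qed.

Lemma greedy_uniq score F ns : uniq (pmap id (greedy score F ns)).
Proof.
elim: ns F => //= N ns IH F; case: best => [k|] /=; last exact: IH.
rewrite IH andbT mem_pmap map_id; apply/negP => /greedy_mem.
by rewrite !inE eqxx.
Qed.

(** Invariant step for runs from [k |: F] and [F]: either the first takes [k], and the less
    preferred choice [c] of the second becomes the new discrepancy, or both choose alike and [k]
    stays the discrepancy. *)
Variant best_setU1_spec score N F k : option S -> option S -> Prop :=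
| BestNew c of k \in N &
    (forall j, c = Some j -> j \in F /\ preferred score k j) :
    best_setU1_spec score N F k (Some k) c
| BestSame c of c <> Some k &
    (k \in N -> exists2 j, c = Some j & preferred score j k) &
    (forall j, c = Some j -> j \in F) :
    best_setU1_spec score N F k c c.

Lemma best_setU1 score N F k : k \notin F ->
  best_setU1_spec score N F k (best score (N :&: (k |: F))) (best score (N :&: F)).
Proof.
move=> kF.
case: (bestP _ (N :&: (k |: F))) => [j /setIP[jN jkF] jm|F0].
  have [jk|jk] := eqVneq j k.
    rewrite jk; rewrite jk in jm jN; apply: BestNew => // l lE.
    have : l \in N :&: F by move: lE; case: bestP => // i iF _ [<-].
    rewrite inE => /andP[lN lF]; split => //.
    by apply: jm; rewrite !inE lN lF orbT.
  have jF : j \in F by move: jkF; rewrite !inE (negPf jk).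
  have -> : best score (N :&: F) = Some j.
    apply: best_eq => [|i]; first by rewrite inE jN.
    by rewrite inE => /andP[iN iF]; apply: jm; rewrite !inE iN iF orbT.
  apply: BestSame => [[]|kN|i [<-]//]; first exact/eqP.
  by exists j => //; apply: jm; rewrite !inE kN eqxx.
have -> : best score (N :&: F) = None.
  case: bestP => // j /setIP[jN jF] _.
  have : j \in N :&: (k |: F) by rewrite !inE jN jF orbT.
  by rewrite F0 inE.
apply: BestSame => // kN.
have : k \in N :&: (k |: F) by rewrite !inE kN eqxx.
by rewrite F0 inE.
Qed.

Lemma remove_setU1_new k F : k \notin F -> remove (Some k) (k |: F) = F.
Proof. by move=> kF; rewrite /= finset.setU1K. Qed.

Lemma remove_setU1_same c k F : c <> Some k ->
  remove c (k |: F) = k |: remove c F.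
Proof.
case: c => //= j jk; apply/setP => i; rewrite !inE.
have [->|] := eqVneq i k; rewrite ?andbT//=.
by apply/eqP => kj; apply: jk; rewrite kj.
Qed.

Lemma notin_remove c k F : k \notin F -> k \notin remove c F.
Proof. by case: c => //= j; apply: contra => /setD1P[]. Qed.

Lemma assign_weight_cons w c s :
  assign_weight w (c :: s) = (if c is Some j then w j else 0) + assign_weight w s.
Proof. by rewrite /assign_weight big_cons. Qed.

(* Alternating path: the runs from [k |: F] and [F] always differ by at most one
   free seller, which can only become less preferred. *)
Lemma greedy_weight_setU1 score w (B : R) F k ns :
  0 <= B -> (forall j, 0 <= w j) -> k \notin F ->
  (forall j, preferred score k j -> w j <= B) ->
  w k - B <= assign_weight w (greedy score (k |: F) ns) -
             assign_weight w (greedy score F ns) <= w k.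
Proof.
move=> B0 w0; elim: ns F k => [|N ns IH] F k kF kB.
  by rewrite subrr w0 andbT; have := kB k (preferred_refl _ _); lra.
rewrite [greedy _ _ _]/= [greedy _ F _]/=.
case: (best_setU1 score N F k kF) => [c kN cF|c ck kN cF].
  rewrite remove_setU1_new// !assign_weight_cons.
  case: c cF => [j|] cF; last by rewrite /=; apply/andP; split; lra.
  have [jF kj] := cF j erefl.
  have jB l : preferred score j l -> w l <= B.
    by move=> jl; apply/kB/(preferred_trans _ _ _ _ kj).
  (* The runs continue from [F] and [F :\ j], so [j] takes over the role of [k], and [w k - w j]
     telescopes with the bounds for [j]. *)
  have := IH (F :\ j) j _ jB; rewrite finset.setD1K// !inE eqxx => /(_ isT) /andP[? ?].
  by apply/andP; split; lra.
rewrite remove_setU1_same// !assign_weight_cons.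
by have /andP[? ?] := IH (remove c F) k (notin_remove c k F kF) kB; apply/andP; split; lra.
Qed.

Definition utility score c : R := if c is Some j then score j else 0.

(** The run from the larger set always has at least the free sellers of the other, so no buyer is
    worse off. *)
Lemma greedy_utility_setU1 score F k ns i : (forall j, 0 <= score j) -> k \notin F ->
  utility score (nth None (greedy score F ns) i) <=
  utility score (nth None (greedy score (k |: F) ns) i).
Proof.
move=> s0; elim: ns F k i => [|N ns IH] F k i kF; first by rewrite nth_nil.
rewrite [greedy _ F _]/= [greedy _ (k |: F) _]/=.
case: (best_setU1 score N F k kF) => [c kN cF|c ck kN cF]; case: i => [|i] //=.
- by case: c cF => [j /(_ j erefl) [_ /preferred_score]|] /=.
- rewrite finset.setU1K//; case: c cF => [j /(_ j erefl)[jF _]|] //=.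
  by have := IH (F :\ j) j i; rewrite finset.setD1K// !inE eqxx => /(_ isT).
- by rewrite remove_setU1_same// IH// notin_remove.
Qed.

(** As long as [k] is unsold the two runs make the same choices; if [k] is still free when buyer [i]
    arrives, it beats what [i] would get otherwise. *)
Lemma greedy_sold score F k ns i : k \notin F -> (i < size ns)%N ->
  k \in nth finset.set0 ns i ->
  utility score (nth None (greedy score F ns) i) < score k ->
  Some k \in greedy score (k |: F) ns.
Proof.
elim: ns F i => [|N ns IH] F i kF //.
rewrite [greedy _ F _]/= [greedy _ (k |: F) _]/=.
case: (best_setU1 score N F k kF) => [c kN cF|c ck kN cF]; first by rewrite mem_head.
case: i => [_ /= /kN[j -> /preferred_score /=]|i /= ins kns uk]; first by case: ltgtP.
by rewrite inE remove_setU1_same// (IH (remove c F) i) ?orbT// notin_remove.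
Qed.

(** The primal-dual accounting: a sold seller's weight is its buyer's surplus plus the price paid.
    Each seller is sold at most once, which lets the prices be summed over sellers. *)
Lemma greedy_weight_split score w F ns :
  assign_weight w (greedy score F ns) =
  \sum_(c <- greedy score F ns) utility score c +
  \sum_j (if Some j \in greedy score F ns then w j - score j else 0).
Proof.
set t := greedy score F ns.
have -> : \sum_j (if Some j \in t then w j - score j else 0) =
    \sum_(c <- t) (if c is Some j then w j - score j else 0).
  rewrite -big_mkcond /=.
  rewrite (eq_bigl (mem (pmap id t))); last first.
    by move=> j; rewrite /= mem_pmap map_id.
  rewrite -big_uniq ?greedy_uniq//=.
  elim: {+}t => [|[j|] r IH]; first by rewrite !big_nil.
    by rewrite /= !big_cons IH.
  by rewrite /= big_cons add0r IH.
rewrite -big_split /assign_weight; apply: eq_bigr => -[j|] _ /=; first by rewrite addrC subrK.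
by rewrite addr0.
Qed.

(** The decision rule sees only the revealed neighbourhoods, so it replays the run to recover the
    free sellers. *)
Definition free_after score (h : seq {set S}) :=
  foldl (fun F N => remove (best score (N :&: F)) F) finset.setT h.

Definition greedy_decision score (h : seq {set S}) :=
  best score (last finset.set0 h :&: free_after score (take (size h).-1 h)).

Lemma run_online_greedy score h ns :
  run_online (greedy_decision score) h (~: free_after score h) ns =
  greedy score (free_after score h) ns.
Proof.
elim: ns h => //= N ns IH h.
have -> : greedy_decision score (rcons h N) = best score (N :&: free_after score h).
  by rewrite /greedy_decision last_rcons size_rcons -cats1 take_size_cat.
set c := best _ _.
have -> : (if c is Some j then
    if (j \in N) && (j \notin ~: free_after score h) then Some j else None
    else None) = c.
  by rewrite /c; case: bestP => // j /setIP[jN jF] _; rewrite jN inE jF.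
have fE : free_after score (rcons h N) = remove c (free_after score h).
  by rewrite /free_after -cats1 foldl_cat.
congr (_ :: _); rewrite -fE -IH; congr run_online.
rewrite fE; case: c {IH fE} => //= j.
by apply/setP => k; rewrite !inE negb_and negbK.
Qed.

Lemma assign_weight_ge0 w s : (forall j, 0 <= w j) -> 0 <= assign_weight w s.
Proof. by move=> w0; apply: sumr_ge0 => -[]. Qed.

End Greedy.

(** * Discrete price levels *)

Section PriceLevels.
Context {R : realType}.
Variables (n : nat) (d : R).
Hypotheses (n_gt0 : (0 < n)%N) (d_ge0 : 0 <= d) (d_le : d <= 1 / 2).

Local Notation N := (n%:R : R).
Let N_gt0 : 0 < N. Proof. by rewrite ltr0n. Qed.
Local Notation q := (expR (- N^-1)).

Definition price (k : nat) : R := Num.min (expR (k%:R / N - 1)) (1 - d).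

Let q_bounds : 1 - N^-1 <= q <= 1.
Proof.
rewrite expR_ge1Dx expR_le1 oppr_le0 invr_ge0 ltW//.
Qed.

Lemma price_ge0 k : 0 <= price k.
Proof. by rewrite le_min expR_ge0/=; move: d_le; lra. Qed.

Lemma price_le k : price k <= 1 - d.
Proof. by rewrite ge_min lexx orbT. Qed.

(* Geometric growth by a factor [e^(1/n) = 1 / q] makes the prices satisfy a
   discrete version of [g' <= g]. *)
Lemma price_step k : q * price k.+1 <= price k.
Proof.
have /andP[q0 q1] := q_bounds; have qp : 0 <= q by exact: expR_ge0.
have e : expR (k.+1%:R / N - 1) * q = expR (k%:R / N - 1).
  by rewrite -expRD; congr expR; rewrite -natr1; field; rewrite gt_eqF.
rewrite /price le_min; apply/andP; split.
  by rewrite -e mulrC ler_wpM2r// ge_min lexx.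
have := price_le k.+1; have := price_ge0 k.+1; rewrite /price; nra.
Qed.

Lemma price_incr k : price k.+1 - price k <= N^-1 * price k.+1.
Proof.
have := price_step k; have := price_ge0 k.+1; have /andP[] := q_bounds; nra.
Qed.

Lemma price0_le : q * price 0 <= expR (- 1).
Proof.
have /andP[q0 q1] := q_bounds; have qp : 0 <= q by exact: expR_ge0.
have : price 0 <= expR (- 1) by rewrite /price mul0r sub0r ge_min lexx.
have := price_ge0 0; nra.
Qed.

(* Discrete form of [\int g 1{g < y} >= y - 1/e]. *)
Lemma sum_price_lt (y : R) m : y <= 1 ->
  Num.min (price m) (q * y) - expR (- 1) <=
  N^-1 * \sum_(k < m.+1) price k * (price k < y)%R%:R.
Proof.
move=> y1; have /andP[q0 q1] := q_bounds; have qp : 0 <= q by exact: expR_ge0.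
have Ni : 0 <= N^-1 by rewrite invr_ge0 ltW.
elim: m => [|m IH].
  rewrite big_ord_recl big_ord0 addr0.
  have := price0_le; have := price_ge0 0; have := expR_ge0 (-1 : R).
  case: (ltP (price 0) y) => py; rewrite /= ?mulr1 ?mulr0.
    move=> e0 p0 pq; have : Num.min (price 0) (q * y) <= price 0 by rewrite ge_min lexx.
    nra.
  have : Num.min (price 0) (q * y) <= q * y by rewrite ge_min lexx orbT.
  nra.
rewrite big_ord_recr mulrDr -lerBlDr; apply: le_trans IH => /=.
have st := price_step m; have inc := price_incr m.
case: (ltP (price m.+1) y) => py; rewrite /= ?mulr1 ?mulr0.
  have np : 0 <= N^-1 * price m.+1 by rewrite mulr_ge0// price_ge0.
  by case: (leP (price m.+1) (q * y)) => ?; case: (leP (price m) (q * y)) => ?; lra.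
(* Once a price reaches [y] the sum stops growing, but the minimum is already saturated at [q * y];
   the factor [q] absorbs the overshoot of one level. *)
have qy : q * y <= price m by nra.
rewrite (min_r qy); have : Num.min (price m.+1) (q * y) <= q * y by rewrite ge_min lexx orbT.
by lra.
Qed.


(** By [1 + u <= e^u], the exponential is at least [1 - d] on the top fraction [d] of the levels. *)
Lemma price_top k : n%:R - k%:R <= d * N -> price k = 1 - d.
Proof.
move=> kd; rewrite /price min_r//; apply: le_trans (expR_ge1Dx _).
have -> : 1 + (k%:R / N - 1) = k%:R / N by ring.
by rewrite ler_pdivlMr// mulrBl mul1r; move: kd; lra.
Qed.

(** The levels below the plateau contribute about [1 - d - 1/e] and the plateau, of width [d], about
    [d (1 - d)]; together [1 - 1/e - d^2]. Rounding costs at most [1/N] in each part. *)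
Lemma sum_price : 0 < d ->
  1 - expR (- 1) - (d ^+ 2 + 2 / N) <= N^-1 * \sum_(k < n) price k.
Proof.
move=> d0; have /andP[q0 q1] := q_bounds; have qp : 0 <= q by exact: expR_ge0.
have Ni : 0 < N^-1 by rewrite invr_gt0.
have NNi : N * N^-1 = 1 by rewrite divff// gt_eqF.
pose D := Num.truncn (d * N).
have /andP[D1 D2] : D%:R <= d * N < D.+1%:R.
  by apply: truncn_itv; rewrite mulr_ge0// ltW.
have Dn : (D < n)%N.
  rewrite -(ltr_nat R); apply: le_lt_trans D1 _.
  by move: d_le; nra.
have nE : n = ((n - D).-1.+1 + D)%N by rewrite prednK ?subn_gt0// subnK// ltnW.
have top k : ((n - D).-1.+1 <= k)%N -> price k = 1 - d.
  move=> kD; apply: price_top; apply: le_trans D1.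
  by rewrite lerBlDr -natrD ler_nat; rewrite {1}nE addnC leq_add2l.
rewrite -(big_mkord xpredT price) (@big_cat_nat _ _ _ (n - D).-1.+1)//=; last first.
  by rewrite [leqRHS]nE leq_addr.
have -> : \sum_((n - D).-1.+1 <= k < n) price k = D%:R * (1 - d).
  rewrite (eq_big_nat _ _ (F2 := fun=> 1 - d)); last first.
    by move=> k /andP[kD _]; apply: top.
  by rewrite big_const_nat iter_addr_0 {1}nE addKn mulr_natl.
rewrite big_mkord mulrDr.
(* All prices lie below [y = 1], so the truncated sum is the plain one. *)
have lt1 (k : nat) : price k < 1 by have := price_le k; lra.
have := sum_price_lt 1 (n - D).-1 (lexx 1).
under eq_bigr => k _ do rewrite lt1 mulr1.
rewrite mulr1 => h.
have : q * (1 - d) <= Num.min (price (n - D).-1) q.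
  rewrite le_min -(top _ (leqnn _)) price_step top//.
  by move: d_le; nra.
have DN : d - N^-1 <= N^-1 * D%:R.
  by move: D2; rewrite -natr1; nra.
have : (1 - N^-1) * (1 - d) <= q * (1 - d) by rewrite ler_wpM2r//; move: d_le; lra.
have : (d - N^-1) * (1 - d) <= N^-1 * D%:R * (1 - d).
  by rewrite ler_wpM2r//; move: d_le; lra.
by nra.
Qed.

(* The discrete form of the inequality behind Ranking:
   [E (g(x) 1{g(x) < y}) + (1 - y) >= 1 - 1/e] up to an error. *)
Lemma mean_price_lt (y : R) : 0 < d -> y <= 1 ->
  1 - expR (- 1) - (d ^+ 2 + 2 / N) <=
  N^-1 * \sum_(k < n) price k * (price k < y)%R%:R + (1 - y).
Proof.
move=> d0 y1; have /andP[q0 q1] := q_bounds; have qp : 0 <= q by exact: expR_ge0.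
have Ni : 0 < N^-1 by rewrite invr_gt0.
(* Above the cap every price counts and the full sum suffices. Below it the sum gives [q * y - 1/e],
   and [1 - y] makes up the rest within [y (1 - q) <= 1/N]. *)
have [yd|dy] := leP y (1 - d); last first.
  under eq_bigr => k _ do rewrite (le_lt_trans (price_le k) dy) mulr1.
  by have := sum_price d0; lra.
have nE : n.-1.+1 = n by rewrite prednK.
have := sum_price_lt y n.-1 y1; rewrite nE => h.
have top : price n = 1 - d by apply: price_top; rewrite subrr mulr_ge0// ltW.
have st : q * (1 - d) <= price n.-1 by rewrite -top; have := price_step n.-1; rewrite nE.
have : q * y <= Num.min (price n.-1) (q * y) by rewrite le_min lexx andbT; nra.
have : y * (1 - q) <= N^-1 by nra.
have := sqr_ge0 d; have -> : 2 / N = N^-1 + N^-1 by ring.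
by move: h; lra.
Qed.

End PriceLevels.

(** * A uniform seed *)

Section UniformSeed.
Context {R : realType} {T : finType} (x0 : T).

(** Seeds are coded in [nat], where every set is measurable; only indices below [#|T|] get mass, so
    the default [x0] is harmless. *)
Definition seed (k : nat) : T := nth x0 (enum T) k.

(* [x0] witnesses that [T] is inhabited, without which this measure is zero; it
   is an argument so that the probability instance below can be inferred. *)
Definition uniform_seed_of of T : set nat -> \bar R :=
  mscale ((#|T|%:R : R)^-1)%:nng (msum (fun k : nat => \d_k) #|T|).

Notation uniform_seed := (uniform_seed_of x0).

HB.instance Definition _ := Measure.on uniform_seed.

Lemma uniform_seedE (p : pred T) (A : set nat) :
  (forall k, A k <-> p (seed k)) ->
  uniform_seed A = (mean T (fun x => (p x)%:R))%:E.
Proof.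
move=> Ap; rewrite /uniform_seed_of /mscale /msum /= /mean EFinM; congr (_ * _)%E.
rewrite -sumEFin -[in RHS]big_enum /= (big_nth x0) -cardE big_mkord.
apply: eq_bigr => k _; transitivity (((k : nat) \in A)%:R%:E : \bar R); first exact: diracE.
congr ((nat_of_bool _)%:R%:E).
by apply/idP/idP; rewrite in_setE => /Ap.
Qed.

Lemma uniform_seedT : uniform_seed setT = 1%E.
Proof.
have T0 : (0 < #|T|)%N by apply/card_gt0P; exists x0.
by rewrite (uniform_seedE predT) //= mean_const.
Qed.

HB.instance Definition _ :=
  @Measure_isProbability.Build _ _ R uniform_seed uniform_seedT.

End UniformSeed.

(** * Expected weight and sensitivity of Ranking *)

Section Ranking.
Context {R : realType} {S : finType}.
Variables (n : nat) (d : R) (w : S -> R) (ns : seq {set S}).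
Hypotheses (d_gt0 : 0 < d) (d_le : d <= 1 / 2) (w_ge0 : forall j, 0 <= w j).

Let K := 'I_n.+1.
Implicit Types (x : {ffun S -> K}) (j : S).

Definition score x j : R := w j * (1 - price n.+1 d (x j)).

Definition ranking_run x (F : {set S}) := greedy (score x) F ns.

Definition ranking_weight x : R := assign_weight w (ranking_run x finset.setT).

Definition revenue x j : R :=
  if Some j \in ranking_run x finset.setT then w j - score x j else 0.

Let price_ge0' k : 0 <= price n.+1 d k. Proof. exact: price_ge0. Qed.

Let price_le' k : price n.+1 d k <= 1 - d. Proof. exact: price_le. Qed.

Lemma score_ge0 x j : 0 <= score x j.
Proof. by rewrite mulr_ge0//; have := price_le' (x j); move: d_gt0; lra. Qed.

Lemma utility_ge0 x c : 0 <= utility (score x) c.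
Proof. by case: c => //= j; apply: score_ge0. Qed.

Lemma score_le x j : score x j <= w j.
Proof. by rewrite ler_piMr//; have := price_ge0' (x j); lra. Qed.

Lemma revenue_ge0 x j : 0 <= revenue x j.
Proof. by rewrite /revenue; case: ifP => // _; rewrite subr_ge0 score_le. Qed.

Lemma setT_setU1 j : j |: (~: [set j])%SET = finset.setT.
Proof. by apply/setP => k; rewrite !inE orbN. Qed.

Lemma score_upd x j a : {in (~: [set j])%SET, score (upd x j a) =1 score x}.
Proof. by move=> k; rewrite !inE /score ffunE => /negPf->. Qed.

Lemma ranking_run_upd x j a :
  ranking_run (upd x j a) (~: [set j])%SET = ranking_run x (~: [set j])%SET.
Proof. exact/eq_greedy/score_upd. Qed.

Lemma ranking_weight_setC1 x j :
  w j - w j / d <=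
  ranking_weight x - assign_weight w (ranking_run x (~: [set j])%SET) <= w j.
Proof.
rewrite /ranking_weight -(setT_setU1 j); apply: greedy_weight_setU1 => //.
- by rewrite divr_ge0// ltW.
- by rewrite !inE negbK.
(* The cap gives [d * w k <= score x k <= score x j <= w j]. *)
- move=> k /preferred_score kj; rewrite ler_pdivlMr//.
  apply: le_trans (score_le x j); apply: le_trans kj.
  by rewrite ler_wpM2l//; have := price_le' (x k); lra.
Qed.

(** The run without [j] ignores the price of [j], and both weights lie in the same interval of
    length [w j / d] relative to it. *)
Lemma ranking_bounded_diff : bounded_diff (fun j => w j / d) ranking_weight.
Proof.
move=> j x a; have := ranking_weight_setC1 x j; have := ranking_weight_setC1 (upd x j a) j.
by rewrite ranking_run_upd ler_norml => /andP[? ?] /andP[? ?]; apply/andP; split; lra.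
Qed.

Let d2 : 1 / 2 <= 1 - d. Proof. by move: d_le; lra. Qed.

Local Notation loss := (d ^+ 2 + 2 / n.+1%:R).

(** [mean_price_lt] scaled by [v] at [y = 1 - u / v]: [u] is the buyer's utility without the seller,
    [v] the seller's weight. *)
Lemma mean_level (u v : R) : 0 <= u -> 0 <= v ->
  v * (1 - expR (- 1) - loss) <=
  mean K (fun a => u + v * (price n.+1 d a * (u < v * (1 - price n.+1 d a))%R%:R)).
Proof.
move=> u0; rewrite le_eqVlt => /predU1P[<-|v0].
  by rewrite mul0r; apply: mean_ge0 => a; rewrite mul0r addr0.
rewrite meanD meanZ mean_const ?card_ord//.
have y1 : 1 - u / v <= 1 by rewrite gerBl divr_ge0// ltW.
have := mean_price_lt n.+1 d (ltn0Sn n) (ltW d_gt0) d_le (1 - u / v) d_gt0 y1.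
rewrite -(ler_pM2l v0) => /le_trans; apply.
rewrite mulrDr; have -> : v * (1 - (1 - u / v)) = u by field; rewrite gt_eqF.
rewrite addrC lerD2l (ler_pM2l v0) /mean card_ord ler_pM2l ?invr_gt0//.
apply: ler_sum => a _; rewrite ler_wpM2l// ler_nat.
have -> : (price n.+1 d a < 1 - u / v) = (u < v * (1 - price n.+1 d a)).
  by rewrite ltrBrDr -ltrBrDl ltr_pdivrMr// mulrC.
exact: leqnn.
Qed.

(** Fix all prices but that of [j], and let [u] be the utility of buyer [i] in the run without [j].
    For any price of [j] the buyer gets at least [u], and [j] is sold whenever its surplus exceeds
    [u]; then average over this price. *)
Lemma mean_edge j (i : nat) : (i < size ns)%N -> j \in nth finset.set0 ns i ->
  w j * (1 - expR (- 1) - loss) <=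
  mean _ (fun x => utility (score x) (nth None (ranking_run x finset.setT) i) +
                   revenue x j).
Proof.
move=> ins jN; rewrite -(mean_resample _ j) ?card_ord//.
have T0 : (0 < #|{ffun S -> K}|)%N by rewrite card_ffun expn_gt0 card_ord.
rewrite -[leLHS](mean_const {ffun S -> K} _ T0); apply: ler_mean => x.
pose u := utility (score x) (nth None (ranking_run x (~: [set j])%SET) i).
apply: le_trans (mean_level u (w j) (utility_ge0 _ _) (w_ge0 j)) _.
apply: ler_mean => a; set x' := upd x j a.
have jF : j \notin (~: [set j])%SET by rewrite !inE negbK.
have uE : utility (score x') (nth None (ranking_run x' (~: [set j])%SET) i) = u.
  rewrite /u ranking_run_upd; case cE : (nth _ _ _) => [k|] //=.
  apply: score_upd; apply: (@greedy_mem _ _ (score x) _ ns).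
  by rewrite -cE mem_nth// size_greedy.
have sE : score x' j = w j * (1 - price n.+1 d a) by rewrite /score ffunE eqxx.
apply: lerD.
  by rewrite -uE -(setT_setU1 j) greedy_utility_setU1//; apply: score_ge0.
have := revenue_ge0 x' j; rewrite /revenue -(setT_setU1 j).
case: ltP => [us _|_ h]; last by rewrite !mulr0.
rewrite (greedy_sold _ _ _ _ i) ?uE ?sE//.
by rewrite mulr1; lra.
Qed.

Lemma sum_matched (m : 'I_(size ns) -> option S) (r : S -> R) :
  (forall i i' j, m i = Some j -> m i' = Some j -> i = i') -> (forall j, 0 <= r j) ->
  \sum_i (if m i is Some j then r j else 0) <= \sum_j r j.
Proof.
move=> m_inj r0.
have -> : \sum_i (if m i is Some j then r j else 0) =
    \sum_j \sum_(i | m i == Some j) r j.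
  rewrite [RHS](exchange_big_dep xpredT)//=; apply: eq_bigr => i _.
  case: (m i) => [j|]; last by rewrite big_pred0.
  by rewrite (big_pred1 j)// => k; rewrite /= eq_sym (inj_eq Some_inj).
apply: ler_sum => j _.
have [i0 /eqP mi0|no] := pickP (fun i => m i == Some j); last by rewrite big_pred0.
rewrite (big_pred1 i0)// => i /=; apply/eqP/eqP => [mi|->//].
exact: m_inj mi mi0.
Qed.

(** Weak duality: a matching uses each buyer and seller at most once, so its edge gains sum to at
    most the weight of the run. *)
Lemma mean_ranking_weight (m : 'I_(size ns) -> option S) : is_matching m ->
  (1 - expR (- 1) - loss) * matching_weight w m <= mean _ ranking_weight.
Proof.
move=> [mN m_inj].
pose gain x (i : 'I_(size ns)) : R := if m i is Some j then
  utility (score x) (nth None (ranking_run x finset.setT) i) + revenue x j else 0.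
have gainP x : \sum_i gain x i <= ranking_weight x.
  rewrite /ranking_weight (greedy_weight_split (score x)).
  apply: (@le_trans _ _ (\sum_(i < size ns)
      utility (score x) (nth None (ranking_run x finset.setT) i)
    + \sum_i (if m i is Some j then revenue x j else 0))).
    rewrite -big_split; apply: ler_sum => i _ /=; rewrite /gain.
    by case: (m i) => // ; rewrite addr0 utility_ge0.
  apply: lerD; last exact/sum_matched/revenue_ge0.
  rewrite [leRHS](big_nth None) size_greedy big_mkord.
  exact: lexx.
apply: le_trans (ler_mean _ _ _ gainP).
rewrite mean_sum /matching_weight mulr_sumr; apply: ler_sum => i _; rewrite /gain.
case mi : (m i) => [j|]; last by rewrite mulr0 mean_ge0.
by rewrite mulrC; apply: mean_edge => //; apply: mN.
Qed.

End Ranking.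

(** * The algorithm *)

Section RankingAlgorithm.
Context {R : realType} {S : finType}.
Variables (n : nat) (d : R) (w : S -> R).

Let x0 : {ffun S -> 'I_n.+1} := [ffun=> ord0].

Definition ranking_alg : RandOnlineAlg R S :=
  {| ra_disp := default_measure_display;
     ra_space := nat;
     ra_prob := uniform_seed_of x0;
     ra_dec := fun k => greedy_decision (score n d w (seed x0 k));
     ra_meas := fun _ _ => I |}.

Lemma ranking_alg_weight ns (k : ra_space ranking_alg) :
  alg_weight w ns k = ranking_weight n d w ns (seed x0 k).
Proof.
rewrite /alg_weight /ranking_weight /ranking_run -(run_online_greedy _ [::]).
by rewrite /free_after /= finset.setCT.
Qed.

Lemma ranking_alg_prob ns (t : R) :
  ra_prob ranking_alg (fun k : ra_space ranking_alg => (alg_weight w ns k < t)%R : Prop) =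
  (mean _ (fun x => (ranking_weight n d w ns x < t)%R%:R))%:E.
Proof.
by apply: uniform_seedE => k; rewrite ranking_alg_weight.
Qed.

Lemma ranking_tail ns (m : 'I_(size ns) -> option S) (t : R) :
  0 < d -> d <= 1 / 2 -> (forall j, 0 <= w j) -> is_matching m ->
  0 <= t -> 0 < norm2sq w ->
  mean _ (fun x => (ranking_weight n d w ns x <
     (1 - expR (- 1) - (d ^+ 2 + 2 / n.+1%:R)) * matching_weight w m - t)%R%:R) <=
  expR (- (t ^+ 2 * d ^+ 2 / (8 * norm2sq w))).
Proof.
move=> d0 d_le w0 mP t0 V0.
have VE : \sum_j (w j / d) ^+ 2 = norm2sq w / d ^+ 2.
  by rewrite /norm2sq mulr_suml; apply: eq_bigr => j _; rewrite exprMn exprVn.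
have VE0 : 0 < \sum_j (w j / d) ^+ 2 by rewrite VE divr_gt0// exprn_gt0.
have -> : t ^+ 2 * d ^+ 2 / (8 * norm2sq w) = t ^+ 2 / (8 * \sum_j (w j / d) ^+ 2).
  by rewrite VE; field; rewrite !gt_eqF.
apply: bounded_diff_tail t0 VE0 _; first by rewrite card_ord.
- by move=> j; rewrite divr_ge0// ltW.
- exact: ranking_bounded_diff.
- move=> x /ltW /le_trans; apply.
  by rewrite lerD2r; apply: mean_ranking_weight.
Qed.

End RankingAlgorithm.

(** * Degenerate cases and choice of constants *)

Lemma matching_weight_ge0 (R : realType) (S : finType) (w : S -> R) ns
    (m : 'I_(size ns) -> option S) :
  (forall j, 0 <= w j) -> 0 <= matching_weight w m.
Proof. by move=> w0; apply: sumr_ge0 => i _; case: (m i). Qed.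

Lemma norm2sq_gt0 (R : realType) (S : finType) (w : S -> R) ns
    (m : 'I_(size ns) -> option S) :
  0 < matching_weight w m -> 0 < norm2sq w.
Proof.
move=> W0; rewrite lt0r andbC sumr_ge0 /= => [|j _]; last exact: sqr_ge0.
apply: contraTneq W0 => V0; rewrite -leNgt le_eqVlt; apply/orP; left.
apply/eqP/big1 => i _; case: (m i) => // j.
have := V0; rewrite /norm2sq => /eqP; rewrite psumr_eq0 => [|k _]; last exact: sqr_ge0.
by move=> /allP /(_ j); rewrite mem_index_enum => /(_ isT) /=; rewrite sqrf_eq0 => /eqP.
Qed.

(** Sixth power of [e^(-1/6) >= 5/6], as [(5/6)^6 > 1/3]. *)
Lemma expRN1_ge (R : realType) : 1 / 3 <= expR (- 1 : R).
Proof.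
have -> : (- 1 : R) = - (1 / 6) * 6%:R by field.
rewrite expRM_natr.
have : 5 / 6 <= expR (- (1 / 6) : R) by have := expR_ge1Dx (- (1 / 6) : R); lra.
move=> e6; have := lerXn2r 6 _ _ e6; rewrite !nnegrE expR_ge0 => /(_ _ isT).
have -> : 0 <= 5 / 6 :> R by lra.
by move=> /(_ isT); apply: le_trans; rewrite !exprS expr0; lra.
Qed.

Theorem theorem3 (R : realType) (alpha : R) :
  0 < alpha ->
  exists A : forall (S : finType) (w : S -> R), RandOnlineAlg R S,
    forall (S : finType) (w : S -> R) (ns : seq {set S})
           (m : 'I_(size ns) -> option S),
      (forall j, 0 <= w j) ->
      is_matching m ->
      (ra_prob (A S w)
         (fun x : ra_space (A S w) => (alg_weight w ns x
                  < (1 - expR (-1) - alpha) * matching_weight w m)%R : Prop)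
       < (expR (- (1 / 50) * alpha ^+ 4
                * (matching_weight w m) ^+ 2 / norm2sq w))%:E)%E.
Proof.
(* Both parameters depend on [alpha] only; [n] makes the rounding loss at most [alpha / 20]. *)
move=> a0; pose n := Num.truncn (40 / alpha); pose d := 2 / 3 * alpha.
exists (fun S w => @ranking_alg R S n d w) => S w ns m w0 mP.
set W := matching_weight w m; set V := norm2sq w.
rewrite ranking_alg_prob lte_fin.
have W0 : 0 <= W by apply: matching_weight_ge0.
(* For a nonpositive target the event is empty and the bound is strict because the exponential is
   positive. *)
have [T0|T0] := leP ((1 - expR (- 1) - alpha) * W) 0.
  rewrite (_ : mean _ _ = 0) ?expR_gt0//.
  rewrite /mean big1 ?mulr0// => x _; rewrite ltNge (le_trans T0)//.
  exact: assign_weight_ge0.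
have Wp : 0 < W by rewrite lt_neqAle W0 andbT; apply: contraTneq T0 => <-; rewrite mulr0 ltxx.
have V0 : 0 < V by apply: norm2sq_gt0 Wp.
have aW : 0 < alpha * W by rewrite mulr_gt0.
(* A positive target forces [alpha < 1 - 1/e], which also gives [d <= 1/2]. *)
have a1 : alpha < 2 / 3.
  by have := expRN1_ge R; move: T0; rewrite pmulr_lgt0//; lra.
pose loss := d ^+ 2 + 2 / n.+1%:R.
have loss_le : loss <= 7 / 20 * alpha.
  have nE : 2 / n.+1%:R <= alpha / 20.
    have : 40 / alpha < n.+1%:R by rewrite truncnS_gt.
    rewrite ltr_pdivrMr// ler_pdivrMr ?ltr0n//; lra.
  have a2 : alpha ^+ 2 <= 2 / 3 * alpha by rewrite expr2 ler_wpM2r ?ltW.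
  rewrite /loss /d; have -> : (2 / 3 * alpha) ^+ 2 = 4 / 9 * alpha ^+ 2 by field.
  by move: (2 / n.+1%:R) nE => r nE; lra.
(* The slack between the guaranteed mean and the target. *)
pose t := (alpha - loss) * W.
have t_ge : 13 / 20 * alpha * W <= t by rewrite ler_wpM2r//; lra.
have -> : (1 - expR (- 1) - alpha) * W = (1 - expR (- 1) - loss) * W - t.
  by rewrite /t; ring.
clearbody t.
apply: (@le_lt_trans _ _ (expR (- (t ^+ 2 * d ^+ 2 / (8 * V))))).
  by apply: ranking_tail => //; rewrite /d; lra.
rewrite ltr_expR -/W -/V !mulNr ltrN2.
have t2 : (13 / 20 * (alpha * W)) ^+ 2 <= t ^+ 2 by rewrite lerXn2r ?nnegrE; lra.
have -> : t ^+ 2 * d ^+ 2 / (8 * V) = t ^+ 2 * d ^+ 2 / 8 / V.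
  by field; rewrite gt_eqF.
rewrite ltr_pM2r ?invr_gt0// /d.
(* Strictness comes from [(169/400) / 18 > 1/50]. *)
have : 0 < alpha ^+ 4 * W ^+ 2 by rewrite mulr_gt0// exprn_gt0.
have := ler_wpM2r (sqr_ge0 alpha) t2.
have -> : (13 / 20 * (alpha * W)) ^+ 2 * alpha ^+ 2 = 169 / 400 * (alpha ^+ 4 * W ^+ 2).
  by field.
have -> : t ^+ 2 * (2 / 3 * alpha) ^+ 2 / 8 = t ^+ 2 * alpha ^+ 2 / 18 by field.
by lra.
Qed.
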